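(* Let $\mathcal X=\mathbb R^d$ and let $\mathcal H=\{\prod_{i=1}^d[a_i,b_i]\mid a_i,b_i\in[-\infty,\infty]\}$ be the class of axis-parallel boxes in $\mathbb R^d$ (a box labels its points $+1$ and all other points $-1$). There are a query class $Q$ over $\mathbb R^d$ with VC dimension $O(\log d)$ and an efficient algorithm $\mathcal A$ such that for every set $S\subseteq\mathbb R^d$ of $n$ examples, every target hypothesis $h^*\in\mathcal H$ and every labeling domain $L\supseteq S$ (possibly unknown to $\mathcal A$), $\mathcal A$ runs in $O((\tau+n)d\log n)$ time, makes $O(d\log n)$ queries from $Q$ and labels every example in $S$ correctly, where $\tau$ is the running time to implement a single region query.
   Context: Region-query model. Hypotheses are functions $\mathcal X\to\{\pm1\}$; an unknown target $h^*\in\mathcal H$ labels the examples. A region query is a pair $(T,z)$ with $T\subseteq\mathcal X$, $z\in\{\pm1\}$. A query class $Q$ is a set of region queries, fixed before $S$ is seen; its VC dimension is the VC dimension of the set family $\{T : (T,z)\in Q\text{ for some }z\}$. Given a finite dataset $S$ and a labeling domain $L$ with $S\subseteq L\subseteq\mathcal X$, the labeler answers $(T,z)$ with $q(T,z)=1$ if $h^*(x)=z$ for all $x\in T\cap L$ and $0$ otherwise; if $T\cap L=\emptyset$ the answer may be arbitrary. The learner is given $\mathcal H$, $S$ and $Q$ (not $h^*$), adaptively submits queries from $Q$, and finally outputs a label for each example of $S$. Implied constants are absolute; logarithms in asymptotic bounds are read as $\max\{1,\log(\cdot)\}$. *)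

(* Defs.v *)
From HB Require Import structures.
From mathcomp Require Import all_boot all_order all_algebra.
From mathcomp Require Import all_classical all_reals all_analysis.
Set Implicit Arguments.
Unset Strict Implicit.
Unset Printing Implicit Defensive.
Import Order.TTheory GRing.Theory Num.Theory.
Local Open Scope classical_set_scope.
Local Open Scope ring_scope.

(* Labels are booleans: [true] is +1 and [false] is -1. *)
Definition label := bool.

Definition hypothesis (X : Type) := X -> label.

Definition region_query (X : Type) : Type := (set X * label)%type.

(* The corners range over the extended reals, so a side may be unbounded, and
   a box with a_i > b_i, a_i = +oo or b_i = -oo for some i is empty. *)
Definition box (R : realType) (d : nat) (a b : 'I_d -> \bar R) :
    hypothesis 'rV[R]_d :=
  fun x => [forall i, (a i <= (x ord0 i)%:E <= b i)%E].

Definition boxes (R : realType) (d : nat) : set (hypothesis 'rV[R]_d) :=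
  [set h | exists a b : 'I_d -> \bar R, h = box a b].

Definition shatters (X : Type) (F : set (set X)) (A : set X) : Prop :=
  forall B : set X, B `<=` A -> exists2 T, F T & T `&` A = B.

Definition vc_dim (R : realType) (X : Type) (F : set (set X)) : \bar R :=
  ereal_sup [set k%:R%:E | k in
    [set k : nat | exists A : set X, (A #= `I_k)%card /\ shatters F A]].

Definition query_vc_dim (R : realType) (X : Type) (Q : set (region_query X)) :
    \bar R :=
  vc_dim R [set T | exists z, Q (T, z)].

(* Nothing is required of [ans] when the region misses the labeling domain. *)
Definition truthful (X : Type) (h : hypothesis X) (L : set X)
    (q : region_query X) (ans : bool) : Prop :=
  q.1 `&` L !=set0 -> (ans <-> forall x, (q.1 `&` L) x -> h x = q.2).

(* The answer of a labeler may depend on the queries asked before (most recent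
   first), so that the arbitrary answers may be adversarial and need not be
   consistent over time. *)
Definition labeler (X : Type) := seq (region_query X) -> region_query X -> bool.

(* A programming language for the real RAM. There are two memories, one of
   natural numbers and one of real numbers; in both, cells are addressed by
   pairs of natural numbers (thus [NLoad (NConst k) e] reads entry e of the
   k-th array). Real arithmetic is exact and has no rounding operation. On
   natural numbers there is no multiplication, so that unit cost is not
   abused: the length of the numbers grows by at most one bit per operation. *)
Inductive nexp : Type :=
| NConst of nat
| NLoad of nexp & nexp
| NAdd of nexp & nexp
| NSub of nexp & nexp
| NHalf of nexp.

Inductive rexp : Type :=
| RNat of nexp
| RLoad of nexp & nexp
| RAdd of rexp & rexp
| RSub of rexp & rexp
| RMul of rexp & rexp
| RDiv of rexp & rexp.

Inductive bexp : Type :=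
| BNle of nexp & nexp
| BRle of rexp & rexp
| BNot of bexp
| BAnd of bexp & bexp.

(* [Query ns rs e1 e2] submits the region query whose name is the pair of
   lists of the values of [ns] and [rs], and stores the answer bit in the cell
   (e1, e2) of the natural memory. The lengths of these lists are fixed by the
   program text, so names have constant size. *)
Inductive program : Type :=
| Skip
| NStore of nexp & nexp & nexp
| RStore of nexp & nexp & rexp
| Query of seq nexp & seq rexp & nexp & nexp
| Seq of program & program
| If of bexp & program & program
| While of bexp & program.

(* What the names denote; it is fixed together with the query class. *)
Definition query_naming (R : realType) (d : nat) :=
  seq nat -> seq R -> region_query 'rV[R]_d.

Record state (R : realType) (d : nat) := State {
  nmem : nat -> nat -> nat;
  rmem : nat -> nat -> R;
  asked : seq (region_query 'rV[R]_d)
}.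

Definition upd (V : Type) (m : nat -> nat -> V) (a i : nat) (v : V) :
    nat -> nat -> V :=
  fun a' i' => if (a' == a) && (i' == i) then v else m a' i'.

Fixpoint neval (m : nat -> nat -> nat) (e : nexp) : nat :=
  match e with
  | NConst k => k
  | NLoad e1 e2 => m (neval m e1) (neval m e2)
  | NAdd e1 e2 => (neval m e1 + neval m e2)%N
  | NSub e1 e2 => (neval m e1 - neval m e2)%N
  | NHalf e1 => (neval m e1)./2
  end.

Fixpoint reval (R : realType) (m : nat -> nat -> nat) (rm : nat -> nat -> R)
    (r : rexp) : R :=
  match r with
  | RNat e => (neval m e)%:R
  | RLoad e1 e2 => rm (neval m e1) (neval m e2)
  | RAdd r1 r2 => reval m rm r1 + reval m rm r2
  | RSub r1 r2 => reval m rm r1 - reval m rm r2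
  | RMul r1 r2 => reval m rm r1 * reval m rm r2
  | RDiv r1 r2 => reval m rm r1 / reval m rm r2
  end.

Fixpoint beval (R : realType) (m : nat -> nat -> nat) (rm : nat -> nat -> R)
    (b : bexp) : bool :=
  match b with
  | BNle e1 e2 => (neval m e1 <= neval m e2)%N
  | BRle r1 r2 => reval m rm r1 <= reval m rm r2
  | BNot b1 => ~~ beval m rm b1
  | BAnd b1 b2 => beval m rm b1 && beval m rm b2
  end.

(* Evaluation times: one step per node of the expression. *)
Fixpoint ntime (e : nexp) : nat :=
  match e with
  | NConst _ => 1
  | NLoad e1 e2 | NAdd e1 e2 | NSub e1 e2 => (ntime e1 + ntime e2).+1
  | NHalf e1 => (ntime e1).+1
  end.

Fixpoint rtime (r : rexp) : nat :=
  match r with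
  | RNat e => (ntime e).+1
  | RLoad e1 e2 => (ntime e1 + ntime e2).+1
  | RAdd r1 r2 | RSub r1 r2 | RMul r1 r2 | RDiv r1 r2 =>
      (rtime r1 + rtime r2).+1
  end.

Fixpoint btime (b : bexp) : nat :=
  match b with
  | BNle e1 e2 => (ntime e1 + ntime e2).+1
  | BRle r1 r2 => (rtime r1 + rtime r2).+1
  | BNot b1 => (btime b1).+1
  | BAnd b1 b2 => (btime b1 + btime b2).+1
  end.

(* [exec nm lab tau p s t s']: started in state [s], the program [p] halts
   after time [t] in state [s'], where names are read through [nm], the
   queries are answered by [lab] and a query takes time [tau]. For given [nm],
   [lab] and [tau] this is deterministic: [t] and [s'] are determined by [p]
   and [s]. *)
Inductive exec (R : realType) (d : nat) (nm : query_naming R d)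
    (lab : labeler 'rV[R]_d) (tau : nat) :
    program -> state R d -> nat -> state R d -> Prop :=
| ExecSkip s : exec nm lab tau Skip s 1 s
| ExecNStore e1 e2 e s :
    exec nm lab tau (NStore e1 e2 e) s (ntime e1 + ntime e2 + ntime e).+1
      (State (upd (nmem s) (neval (nmem s) e1) (neval (nmem s) e2)
                (neval (nmem s) e))
         (rmem s) (asked s))
| ExecRStore e1 e2 r s :
    exec nm lab tau (RStore e1 e2 r) s (ntime e1 + ntime e2 + rtime r).+1
      (State (nmem s)
         (upd (rmem s) (neval (nmem s) e1) (neval (nmem s) e2)
            (reval (nmem s) (rmem s) r))
         (asked s))
| ExecQuery ns rs e1 e2 s :
    let q := nm [seq neval (nmem s) e | e <- ns]
                [seq reval (nmem s) (rmem s) r | r <- rs] in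
    exec nm lab tau (Query ns rs e1 e2) s
      (tau + (sumn (map ntime ns) + sumn (map rtime rs)
              + ntime e1 + ntime e2))
      (State (upd (nmem s) (neval (nmem s) e1) (neval (nmem s) e2)
                (nat_of_bool (lab (asked s) q)))
         (rmem s) (q :: asked s))
| ExecSeq p1 p2 s t1 s1 t2 s2 :
    exec nm lab tau p1 s t1 s1 -> exec nm lab tau p2 s1 t2 s2 ->
    exec nm lab tau (Seq p1 p2) s (t1 + t2) s2
| ExecIf b p1 p2 s t s' :
    exec nm lab tau (if beval (nmem s) (rmem s) b then p1 else p2) s t s' ->
    exec nm lab tau (If b p1 p2) s (btime b + t).+1 s'
| ExecWhileStop b p s :
    ~~ beval (nmem s) (rmem s) b ->
    exec nm lab tau (While b p) s (btime b).+1 s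
| ExecWhileStep b p s t1 s1 t2 s2 :
    beval (nmem s) (rmem s) b ->
    exec nm lab tau p s t1 s1 -> exec nm lab tau (While b p) s1 t2 s2 ->
    exec nm lab tau (While b p) s (btime b + t1 + t2).+1 s2.

(* The input: n is in the cell (0, 0) and d in the cell (0, 1) of the natural
   memory, coordinate j of example i is in the cell (i, j) of the real memory,
   and all other cells are 0. *)
Definition input (R : realType) (d : nat) (S : seq 'rV[R]_d) : state R d :=
  State
    (upd (upd (fun _ _ => 0%N) 0%N 0%N (size S)) 0%N 1%N d)
    (fun i j => if insub j is Some j' then (nth 0 S i) ord0 j' else 0)
    [::].

(* The output: the label of example i is in the cell (1, i) of the natural
   memory, 1 for the label +1 and 0 for the label -1. *)
Definition labels_correctly (R : realType) (d : nat) (S : seq 'rV[R]_d)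
    (h : hypothesis 'rV[R]_d) (s : state R d) : Prop :=
  forall i : nat, (i < size S)%N ->
    nmem s 1%N i = nat_of_bool (h (nth 0 S i)).

(* The logarithm of asymptotic bounds. *)
Definition log1 (R : realType) (k : nat) : R := Num.max 1 (ln k%:R).

(* Main.v *)
(* A box is cut out by upper bounds on the 2d features +x_j and -x_j. The
   queries ask whether all points of L with feature >= c are negative; for a
   fixed feature their regions form a chain, and 2d chains shatter only
   O(log d) points because a chain has at most one trace of each size. For each
   feature the learner sorts the values on S and finds by binary search the
   largest value v for which some point of L with feature >= v is positive.
   Whatever L is, the examples with feature <= v satisfy the bound of the box on
   this feature, and those with feature > v are negative. Merge sort is run
   bottom-up, so that no recursion is needed. *)
Require Import Defs.
From mathcomp Require Import all_boot all_order all_algebra.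
From mathcomp Require Import all_classical all_reals all_analysis.
From mathcomp Require Import zify ring lra.
Set Implicit Arguments.
Unset Strict Implicit.
Unset Printing Implicit Defensive.
Import Order.TTheory GRing.Theory Num.Theory.
Local Open Scope classical_set_scope.
Local Open Scope ring_scope.

(** * Merging sorted runs *)

Section Merging.
Context {R : realType}.
Implicit Types (f g src dst : nat -> R) (n w k i j p Q : nat).

Definition nondecreasing_on f (a b : nat) : Prop :=
  forall i j, (a <= i)%N -> (i <= j)%N -> (j < b)%N -> f i <= f j.

Definition runs_sorted n w f : Prop :=
  forall q, nondecreasing_on f (q * w)%N (minn (q * w + w) n).

(** Multiplicities are forgotten: the search only needs that the sorted row holds every feature
    value of the sample and no other value. *)
Definition same_values n f g : Prop :=
  (forall i, (i < n)%N -> exists2 j, (j < n)%N & g j = f i) /\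
  (forall j, (j < n)%N -> exists2 i, (i < n)%N & g j = f i).

Lemma same_values_trans n f g (g' : nat -> R) :
  same_values n f g -> same_values n g g' -> same_values n f g'.
Proof.
move=> [fg gf] [gg' g'g]; split=> [i /fg [j /gg' [l ln <-] <-]|j /g'g [l + ->]].
  by exists l.
exact: gf.
Qed.

Lemma runs_sorted1 n f : runs_sorted n 1 f.
Proof.
move=> q i j qi ij; rewrite leq_min => /andP[jq _].
by have -> : i = j by lia.
Qed.

Lemma runs_sorted_all n w f :
  (n <= w)%N -> runs_sorted n w f -> nondecreasing_on f 0 n.
Proof. by move=> nw /(_ 0%N); rewrite mul0n add0n (minn_idPr nw). Qed.

(* The state of a merge pass from runs of width [w] to runs of width [2w]:
   [k] values are written, and the current pair of runs of [src] is
   [[2Qw, p)] and [[p, p + w)], of which [[i, p)] and [[j, p + w)] remain. *)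
Record merging n w src dst k i j p Q : Prop := Merging {
  merging_p : p = (Q * (w + w) + w)%N;
  merging_i : (Q * (w + w) <= i <= p)%N;
  merging_j : (p <= j <= p + w)%N;
  merging_jn : (p < j -> j <= n)%N;
  merging_k : (k + p = i + j)%N;
  merging_done : forall q, (q < Q)%N ->
    nondecreasing_on dst (q * (w + w)) (q * (w + w) + (w + w))%N;
  merging_current : nondecreasing_on dst (Q * (w + w)) k;
  merging_below : forall t u, (Q * (w + w) <= t < k)%N -> (u < n)%N ->
    (i <= u < p)%N || (j <= u < p + w)%N -> dst t <= src u;
  merging_cover : forall u, (u < n)%N -> (u < i)%N || (p <= u < j)%N ->
    exists2 t, (t < k)%N & dst t = src u;
  merging_origin : forall t, (t < k)%N -> exists2 u, (u < n)%N & dst t = src u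
}.

Lemma merging_start n w src dst : merging n w src dst 0 0 w w 0.
Proof.
by split=> //; rewrite ?mul0n; try lia; move=> *; lia.
Qed.

(** Since [k + p = i + j] with [i <= p] and [j <= p + w], reaching [k = p + w] forces both runs to
    be exhausted, so the next pair starts at [k]. *)
Lemma merging_next n w src dst k i j p Q :
  merging n w src dst k i j p Q -> (p + w <= k)%N ->
  merging n w src dst k k (k + w) (k + w) Q.+1.
Proof.
move=> [pE Hi Hj jn kE dn cur bel cov ori] ek.
have QE : (Q.+1 * (w + w) = Q * (w + w) + (w + w))%N by rewrite mulSn addnC.
split; rewrite ?QE; try lia.
- move=> q qQ; case: (ltnP q Q) => [/dn //|Qq].
  have -> : q = Q by lia.
  have -> : (Q * (w + w) + (w + w) = k)%N by lia.
  exact: cur.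
- by move=> a b ? ? ?; lia.
- by move=> u un uk; apply: cov => //; lia.
- exact: ori.
Qed.

(** The common part of taking from the left and from the right run: [u] is the source index taken,
    and its value is least among what remains of the pair. *)
Lemma merging_write n w src dst dst' k i j i' j' p Q u :
  merging n w src dst k i j p Q ->
  (k < n)%N -> (u < n)%N ->
  (((u == i) && (i < p) && (i' == i.+1) && (j' == j)) ||
   ((u == j) && (j < p + w) && (i' == i) && (j' == j.+1)))%N ->
  (forall v, (v < n)%N -> (i' <= v < p)%N || (j' <= v < p + w)%N ->
     src u <= src v) ->
  dst' k = src u -> (forall t, t != k -> dst' t = dst t) ->
  merging n w src dst' k.+1 i' j' p Q.
Proof.
move=> [pE Hi Hj jn kE dn cur bel cov ori] kn un cases least dk dt.
have dlt t : (t < k)%N -> dst' t = dst t by move=> tk; apply: dt; lia.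
split; try lia.
- move=> q qQ a b qa ab bq.
  have qQw : (q * (w + w) + (w + w) <= Q * (w + w))%N.
    by rewrite addnC -mulSn leq_mul2r qQ orbT.
  by rewrite !dlt; [exact: (dn q)|lia|lia].
- move=> a b Qa ab bk; have [->|bneq] := eqVneq b k.
    have [->//|aneq] := eqVneq a k.
    rewrite dk dlt; last lia.
    by apply: bel; lia.
  by rewrite !dlt; [apply: cur; lia|lia|lia].
- move=> t v tk vn vr; have [->|tneq] := eqVneq t k.
    by rewrite dk; apply: least.
  by rewrite dlt; [apply: bel; lia|lia].
- move=> v vn vr; have [->|vu] := eqVneq v u; first by exists k.
  have [|t tk <-] := cov v vn; first lia.
  by exists t; [lia|rewrite dlt].
- move=> t tk; have [->|tneq] := eqVneq t k; first by exists u.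
  have [|v vn E] := ori t; first lia.
  by exists v => //; rewrite dlt //; lia.
Qed.

(** The two halves of block [Q] of width [2w] are the runs number [2Q] and [2Q + 1] of width [w]. *)
Lemma runs_sorted_halves n w src Q a b :
  runs_sorted n w src -> (a <= b)%N -> (b < n)%N ->
  ((Q * (w + w) <= a)%N && (b < Q * (w + w) + w)%N) ||
  ((Q * (w + w) + w <= a)%N && (b < Q * (w + w) + w + w)%N) ->
  src a <= src b.
Proof.
move=> srt ab bn.
have E0 : (Q.*2 * w = Q * (w + w))%N by rewrite addnn -doubleMl doubleMr.
have E1 : (Q.*2.+1 * w = Q * (w + w) + w)%N by rewrite mulSn E0 addnC.
case/orP => /andP[H1 H2].
  by apply: (srt Q.*2); rewrite ?E0 //; lia.
by apply: (srt Q.*2.+1); rewrite ?E1 //; lia.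
Qed.

Lemma merging_left n w src dst dst' k i j p Q :
  runs_sorted n w src -> merging n w src dst k i j p Q ->
  (k < n)%N -> (i < p)%N ->
  ((j < p + w)%N -> (j < n)%N -> src i <= src j) ->
  dst' k = src i -> (forall t, t != k -> dst' t = dst t) ->
  merging n w src dst' k.+1 i.+1 j p Q.
Proof.
move=> srt mg kn ip ij; have [pE Hi Hj jn kE _ _ _ _ _] := mg.
apply: (merging_write (u := i) mg kn); [lia|lia|move=> v vn vr].
case/orP: vr => vr.
  by apply: (runs_sorted_halves srt (Q := Q)); lia.
apply: le_trans (ij _ _) _; [lia|lia|].
by apply: (runs_sorted_halves srt (Q := Q)); lia.
Qed.

Lemma merging_right n w src dst dst' k i j p Q :
  runs_sorted n w src -> merging n w src dst k i j p Q ->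
  (k < n)%N -> (k < p + w)%N ->
  ((i < p)%N -> [/\ (j < p + w)%N, (j < n)%N & src j <= src i]) ->
  dst' k = src j -> (forall t, t != k -> dst' t = dst t) ->
  merging n w src dst' k.+1 i j.+1 p Q.
Proof.
move=> srt mg kn kpw ij; have [pE Hi Hj jn kE _ _ _ _ _] := mg.
(* If the left run is exhausted then [i = p], hence [j = k], which is in range by the hypotheses on
   [k]. *)
have [jpw jltn] : (j < p + w)%N /\ (j < n)%N.
  by case: (ltnP i p) => [/ij[]//|]; lia.
apply: (merging_write (u := j) mg kn jltn); [lia|move=> v vn vr].
case/orP: vr => vr; last by apply: (runs_sorted_halves srt (Q := Q)); lia.
have [|_ _ ji] := ij; first lia.
apply: le_trans ji _.
by apply: (runs_sorted_halves srt (Q := Q)); lia.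
Qed.

Lemma merging_end n w src dst i j p Q :
  merging n w src dst n i j p Q -> (n <= p + w)%N ->
  runs_sorted n (w + w) dst /\ same_values n src dst.
Proof.
move=> [pE Hi Hj jn kE dn cur bel cov ori] npw; split.
  move=> q a b qa ab; rewrite leq_min => /andP[bq bn].
  have [qQ|Qq] := ltnP q Q; first exact: (dn q).
  by apply: cur => //; apply: leq_trans qa; rewrite leq_mul2r Qq orbT.
split=> [u un|t tn]; last exact: ori.
(* Either [i = p] and [j = n], or [j > n]; in the latter case [merging_jn] gives [j = p], whence
   [i = n]. Both ways every index below [n] was taken. *)
by apply: cov => //; lia.
Qed.

End Merging.

(** * Termination within a time bound *)

Section Execution.
Context {R : realType} {d : nat} (nm : query_naming R d)
  (lab : labeler 'rV[R]_d) (tau : nat).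
Implicit Types (s : state R d) (P : state R d -> Prop) (p : program).

Definition holds b s : bool := beval (nmem s) (rmem s) b.

Definition halts p s (T : nat) P : Prop :=
  exists t s', [/\ exec nm lab tau p s t s', (t <= T)%N & P s'].

Lemma halts_weaken p s T T' P P' :
  (T <= T')%N -> (forall s', P s' -> P' s') ->
  halts p s T P -> halts p s T' P'.
Proof.
move=> TT' PP' [t [s' [e tT Ps']]].
by exists t, s'; split; [|exact: leq_trans TT'|exact: PP'].
Qed.

Lemma halts_seq p1 p2 s T1 T2 T P :
  (T1 + T2 <= T)%N -> halts p1 s T1 (fun s1 => halts p2 s1 T2 P) ->
  halts (Seq p1 p2) s T P.
Proof.
move=> TT [t1 [s1 [e1 h1 [t2 [s2 [e2 h2 Ps2]]]]]].
exists (t1 + t2)%N, s2; split=> //; first exact: ExecSeq e1 e2.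
by apply: leq_trans TT; exact: leq_add.
Qed.

(** The index of [I] is fuel bounding the iterations left; a true guard at fuel 0 is contradictory,
    so the loop stops within [k] rounds. *)
Lemma halts_while b p c (I : nat -> state R d -> Prop) k s T P :
  (forall j s1, I j s1 -> holds b s1 -> (0 < j)%N /\ halts p s1 c (I j.-1)) ->
  I k s -> (forall j s1, I j s1 -> ~~ holds b s1 -> P s1) ->
  (k * (btime b + c).+1 + (btime b).+1 <= T)%N ->
  halts (While b p) s T P.
Proof.
move=> step + post; elim: k s T => [|k IH] s T Is cT.
  have [bs|nbs] := boolP (holds b s); first by have [] := step _ _ Is bs.
  exists (btime b).+1, s; split=> //; first exact: ExecWhileStop.
  exact: post Is nbs.
have [bs|nbs] := boolP (holds b s); last first.
  exists (btime b).+1, s; split; first exact: ExecWhileStop.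
    by apply: leq_trans cT; rewrite leq_addl.
  exact: post Is nbs.
have [_ [t1 [s1 [e1 h1 Is1]]]] := step _ _ Is bs.
have [t2 [s2 [e2 h2 Ps2]]] := IH s1 _ Is1 (leqnn _).
exists (btime b + t1 + t2).+1, s2; split=> //.
  exact: ExecWhileStep bs e1 e2.
by apply: leq_trans cT; rewrite mulSn; lia.
Qed.

(** Loop-free programs: their final state and a bound on their time are computed by [result] and
    [cost], so they are verified by evaluation. *)
Fixpoint straight p : bool :=
  match p with
  | Seq p1 p2 | If _ p1 p2 => straight p1 && straight p2
  | While _ _ => false
  | _ => true
  end.

(* Meaningful for [straight] programs only. *)
Fixpoint result p s : state R d :=
  match p with
  | Skip | While _ _ => s
  | NStore e1 e2 e =>
      State (upd (nmem s) (neval (nmem s) e1) (neval (nmem s) e2)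
               (neval (nmem s) e)) (rmem s) (asked s)
  | RStore e1 e2 r =>
      State (nmem s) (upd (rmem s) (neval (nmem s) e1) (neval (nmem s) e2)
               (reval (nmem s) (rmem s) r)) (asked s)
  | Query ns rs e1 e2 =>
      let q := nm [seq neval (nmem s) e | e <- ns]
                  [seq reval (nmem s) (rmem s) r | r <- rs] in
      State (upd (nmem s) (neval (nmem s) e1) (neval (nmem s) e2)
               (nat_of_bool (lab (asked s) q))) (rmem s) (q :: asked s)
  | Seq p1 p2 => result p2 (result p1 s)
  | If b p1 p2 => if holds b s then result p1 s else result p2 s
  end.

Fixpoint cost p : nat :=
  match p with
  | Skip => 1
  | NStore e1 e2 e => (ntime e1 + ntime e2 + ntime e).+1
  | RStore e1 e2 r => (ntime e1 + ntime e2 + rtime r).+1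
  | Query ns rs e1 e2 => tau + (sumn (map ntime ns) + sumn (map rtime rs)
                                + ntime e1 + ntime e2)
  | Seq p1 p2 => cost p1 + cost p2
  | If b p1 p2 => (btime b + maxn (cost p1) (cost p2)).+1
  | While _ _ => 0
  end.

Lemma halts_straight p s T P :
  straight p -> (cost p <= T)%N -> P (result p s) -> halts p s T P.
Proof.
move=> str cT Pr.
suff [t [e tc]] : exists t, exec nm lab tau p s t (result p s) /\ (t <= cost p)%N.
  by exists t, (result p s); split=> //; exact: leq_trans cT.
elim: p s str {T P cT Pr} =>
  [|e1 e2 e|e1 e2 r|ns rs e1 e2|p1 IH1 p2 IH2|b p1 IH1 p2 IH2|//] s /=.
- by exists 1%N; split=> //; constructor.
- by move=> _; eexists; split; [constructor|].
- by move=> _; eexists; split; [constructor|].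
- by move=> _; eexists; split; [constructor|].
- move=> /andP[/(IH1 s)[t1 [E1 h1]] /(IH2 (result p1 s))[t2 [E2 h2]]].
  by exists (t1 + t2)%N; split; [exact: ExecSeq E1 E2|exact: leq_add].
- move=> /andP[/(IH1 s)[t1 [E1 h1]] /(IH2 s)[t2 [E2 h2]]].
  exists (btime b + if holds b s then t1 else t2).+1; split.
    by apply: ExecIf; rewrite -/(holds b s); case: ifP.
  by rewrite ltnS leq_add2l leq_max; case: ifP; rewrite ?h1 ?h2 ?orbT.
Qed.

End Execution.

(** * The learner *)

(* Row 2 of the natural memory holds the variables, and the cell (0, 2) the
   index of the current feature. *)
Definition cell a i : nexp := NLoad (NConst a) (NConst i).
Definition vn := cell 0 0.
Definition vd := cell 0 1.
Definition vm := cell 0 2.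
Definition vw := cell 2 0.
Definition vk := cell 2 1.
Definition vi := cell 2 2.
Definition vj := cell 2 3.
Definition vp := cell 2 4.
Definition vlo := cell 2 5.
Definition vhi := cell 2 6.
Definition vmid := cell 2 7.
Definition vans := cell 2 8.

Definition assign i e : program := NStore (NConst 2) (NConst i) e.
Definition NLt e1 e2 : bexp := BNot (BNle e2 e1).
Definition incr_k : program := assign 1 (NAdd vk (NConst 1)).

(** With no multiplication on natural numbers, the parity [b] of the feature index is the index
    minus twice its half; the sign is then [1 - 2b]. *)
Definition feature_of (e : nexp) : rexp :=
  let b := NSub vm (NAdd (NHalf vm) (NHalf vm)) in
  RMul (RSub (RNat (NConst 1)) (RNat (NAdd b b))) (RLoad e (NHalf vm)).

Definition copy_step : program :=
  Seq (RStore (NAdd vn (NConst 1)) vk (feature_of vk)) incr_k.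

Definition copy_init : program :=
  Seq (assign 0 (NConst 1)) (assign 1 (NConst 0)).

Definition copy_feature : program := Seq copy_init (While (NLt vk vn) copy_step).

(* The runs of width [w] are kept in row [n + w] of the real memory. *)
Definition run_row : nexp := NAdd vn vw.

Definition pass_init : program :=
  Seq (Seq (assign 1 (NConst 0)) (assign 2 (NConst 0)))
      (Seq (assign 3 vw) (assign 4 vw)).

Definition next_runs : program :=
  If (BNle (NAdd vp vw) vk)
    (Seq (assign 2 vk) (Seq (assign 4 (NAdd vk vw)) (assign 3 vp))) Skip.

Definition right_first : bexp :=
  BAnd (BAnd (NLt vj (NAdd vp vw)) (NLt vj vn))
       (BNot (BRle (RLoad run_row vi) (RLoad run_row vj))).

(** The target row [n + 2w] is the source row of the next pass, so a pass does not overwrite what it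
    reads, nor the examples in the rows below [n]. *)
Definition take_run v i : program :=
  Seq (RStore (NAdd run_row vw) vk (RLoad run_row v)) (assign i (NAdd v (NConst 1))).

Definition merge_step : program :=
  Seq (If (BAnd (NLt vi vp) (BNot right_first)) (take_run vi 2) (take_run vj 3)) incr_k.

Definition pass : program :=
  Seq pass_init
    (Seq (While (NLt vk vn) (Seq next_runs merge_step))
         (assign 0 (NAdd vw vw))).

Definition sort_row : program := While (NLt vw vn) pass.

Definition search_init : program :=
  Seq (assign 5 (NConst 0)) (assign 6 vn).

Definition search_step : program :=
  Seq (assign 7 (NHalf (NAdd vlo vhi)))
    (Seq (Query [:: vm] [:: RLoad run_row vmid] (NConst 2) (NConst 8))
      (If (BNle (NConst 1) vans) (assign 6 vmid)
          (assign 5 (NAdd vmid (NConst 1))))).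

(** The final [lo] is the first index whose value gets a positive answer, or [n] if there is
    none. *)
Definition search : program := Seq search_init (While (NLt vlo vhi) search_step).

Definition exclude_step : program :=
  Seq (If (BAnd (NLt vlo vn) (BRle (RLoad run_row vlo) (feature_of vk)))
          (NStore (NConst 1) vk (NConst 0)) Skip) incr_k.

Definition exclude : program :=
  Seq (assign 1 (NConst 0)) (While (NLt vk vn) exclude_step).

Definition feature_round : program :=
  Seq (Seq copy_feature sort_row)
    (Seq (Seq search exclude) (NStore (NConst 0) (NConst 2) (NAdd vm (NConst 1)))).

Definition label_step : program :=
  Seq (NStore (NConst 1) vk (NConst 1)) incr_k.

Definition box_learner : program :=
  Seq (While (NLt vk vn) label_step) (While (NLt vm (NAdd vd vd)) feature_round).

(** * Specifications and running times of the programs *)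

Section Learner.
Context {R : realType} {d : nat}.
Implicit Types (x : 'rV[R]_d) (m n : nat).

(** The default 0 agrees with the layout of [input]. *)
Definition coord_at x (j : nat) : R :=
  if insub j is Some j' then x ord0 j' else 0.

(* Each side of a box bounds one of the 2d features +-x_j from above. *)
Definition feature m x : R :=
  (1 - (odd m + odd m)%:R) * coord_at x m./2.

Definition threshold_query m (c : R) : region_query 'rV[R]_d :=
  ([set x | c <= feature m x], false).

Definition threshold_queries : set (region_query 'rV[R]_d) :=
  [set q | exists m c, (m < d + d)%N /\ q = threshold_query m c].

Definition threshold_naming : query_naming R d :=
  fun ns rs => threshold_query (head 0%N ns) (head 0 rs).

Section Run.
Context (lab : labeler 'rV[R]_d) (tau : nat).
Notation halts := (halts threshold_naming lab tau).
Implicit Types (s : state R d).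

(** Frame condition for copying and sorting: sizes, feature index, labels, examples and query
    history survive; only the variables and the real rows from [n] on may change. *)
Definition keeps s s' : Prop :=
  [/\ forall a i, (a <= 1)%N -> nmem s' a i = nmem s a i,
      forall a i, (a < nmem s 0 0)%N -> rmem s' a i = rmem s a i
    & asked s' = asked s].

Lemma keeps_trans s1 s2 s3 : keeps s1 s2 -> keeps s2 s3 -> keeps s1 s3.
Proof.
move=> [n12 r12 a12] [n23 r23 a23]; split=> [a i a1|a i an|].
- by rewrite n23 ?n12.
- by rewrite r23 ?r12 // n12.
- by rewrite a23.
Qed.

Lemma subn_halves m : (m - (m./2 + m./2) = odd m)%N.
Proof. lia. Qed.

(** Counted loops over the examples. The guard takes time 8, which the constants 10 absorb. *)
Lemma halts_for p c n (I : nat -> state R d -> Prop) s P :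
  (forall k s1, (k < n)%N -> I k s1 -> nmem s1 0 0 = n -> nmem s1 2 1 = k ->
     halts p s1 c
       (fun s2 => [/\ I k.+1 s2, nmem s2 0 0 = n & nmem s2 2 1 = k.+1])) ->
  I 0%N s -> nmem s 0 0 = n -> nmem s 2 1 = 0%N ->
  (forall s1, I n s1 -> P s1) ->
  halts (While (NLt vk vn) p) s (n * (c + 10) + 10) P.
Proof.
move=> step I0 s00 s21 post.
apply: (halts_while (c := c) (k := n) (I := fun r s1 =>
  [/\ I (nmem s1 2 1) s1, nmem s1 0 0 = n & (nmem s1 2 1 + r)%N = n])).
- move=> r s1 [Ik s1n kr]; rewrite /holds /= -ltnNge s1n => kn; split; first lia.
  apply: halts_weaken (step _ _ kn Ik s1n erefl) => // s2 [Ik' s2n s2k].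
  by split; rewrite ?s2k //; lia.
- by rewrite s21 add0n.
- move=> r s1 [Ik s1n kr]; rewrite /holds /= negbK s1n => nk; apply: post.
  by have <- : nmem s1 2 1 = n by lia.
- by rewrite /=; nia.
Qed.

Lemma copy_featureP s n (x : nat -> 'rV[R]_d) :
  nmem s 0 0 = n ->
  (forall k j, (k < n)%N -> rmem s k j = coord_at (x k) j) ->
  halts copy_feature s (n * 100 + 50) (fun s' =>
    [/\ keeps s s', nmem s' 2 0 = 1%N &
        forall k, (k < n)%N -> rmem s' (n + 1) k = feature (nmem s 0 2) (x k)]).
Proof.
move=> sn sx; apply: (halts_seq (T1 := 20) (T2 := (n * (60 + 10) + 10))); first lia.
apply: halts_straight; [by []|exact: erefl|].
apply: (halts_for (I := fun k s' => [/\ keeps s s', nmem s' 2 0 = 1%N &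
  forall t, (t < k)%N -> rmem s' (n + 1) t = feature (nmem s 0 2) (x t)])) => //.
- move=> k s1 kn [ks s1w IH] s1n s1k; have [ks0 ks1 _] := ks.
  apply: halts_straight; [by []|exact: erefl|].
  rewrite /= subn_halves s1n s1k ks0 // ks1 ?sn // sx // -/(feature _ _).
  rewrite /upd /= addn1; split=> //; split=> //.
    apply: keeps_trans ks _; split=> [[|[|a]]//|a i /=|//].
    by rewrite s1n; case: eqP => //= ->; lia.
  move=> t tk; rewrite addn1 eqxx /=.
  by case: eqP => [->//|tneq]; rewrite -addn1 IH //; lia.
- by split=> //; split=> // -[|[|a]].
Qed.

Lemma passP s n w :
  nmem s 0 0 = n -> nmem s 2 0 = w -> (0 < w)%N ->
  runs_sorted n w (rmem s (n + w)) ->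
  halts pass s (n * 250 + 100) (fun s' =>
    [/\ keeps s s', nmem s' 2 0 = (w + w)%N,
        runs_sorted n (w + w) (rmem s' (n + (w + w)))
      & same_values n (rmem s (n + w)) (rmem s' (n + (w + w)))]).
Proof.
move=> sn sw w0 srt.
apply: (halts_seq (T1 := 40) (T2 := n * 250 + 60)); first lia.
apply: halts_straight; [by []|exact: erefl|].
apply: (halts_seq (T1 := (n * (240 + 10) + 10)) (T2 := 50)); first lia.
apply: (halts_for (I := fun k s' => [/\ keeps s s', nmem s' 2 0 = w,
  rmem s' (n + w) = rmem s (n + w) &
  exists Q, merging n w (rmem s (n + w)) (rmem s' (n + w + w)) k
    (nmem s' 2 2) (nmem s' 2 3) (nmem s' 2 4) Q])) => //=.
- move=> k s1 kn [ks s1w s1r [Q mg]] s1n s1k.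
  apply: (halts_seq (T1 := 60) (T2 := 180)) => //.
  apply: halts_straight; [by []|exact: erefl|].
  set s2 := result _ _ _ _.
  (* Whether or not a new pair of runs was opened, position [k] now lies inside the current pair. *)
  have [ks2 s2w s2r [Q' mg2] [s2n s2k kpw]] :
    [/\ keeps s s2, nmem s2 2 0 = w, rmem s2 = rmem s1,
      exists Q, merging n w (rmem s (n + w)) (rmem s2 (n + w + w)) k
        (nmem s2 2 2) (nmem s2 2 3) (nmem s2 2 4) Q &
      [/\ nmem s2 0 0 = n, nmem s2 2 1 = k & (k < nmem s2 2 4 + w)%N]].
    rewrite /s2 /= /holds /= s1w s1k; case: (leqP (nmem s1 2 4 + w) k) => kpw /=; last first.
      by split=> //; exists Q.
    rewrite /upd /= ?s1w ?s1k; split=> //.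
    - by apply: keeps_trans ks _; split=> // -[|[|a]].
    - by exists Q.+1; exact: merging_next mg kpw.
    - by split=> //; lia.
  move: s2 ks2 s2w s2r mg2 s2n s2k kpw => s2 ks2 s2w s2r mg2 s2n s2k kpw.
  apply: halts_straight; [by []|exact: erefl|].
  (* Source and target rows differ because [w > 0]. *)
  have n_ww : (n + w == n + w + w)%N = false by lia.
  rewrite /= /holds /= s2w s2n s2k s2r s1r -!ltnNge -?ltNge.
  case: ifP => C; rewrite /upd /= s2w s2n s2k n_ww /= addn1.
    case/andP: C => ip nr; split=> //; split=> //.
      apply: keeps_trans ks2 _; split=> [[|[|a]]//|a i /=|//].
      by rewrite s2n s2r; case: eqP => //= ->; lia.
    exists Q'; rewrite addn1 eqxx /=; rewrite s2r in mg2.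
    apply: merging_left srt mg2 kn ip _ _ _; rewrite ?eqxx //.
      by move=> jw jn; move: nr; rewrite jw jn -leNgt.
    by move=> t /negPf ->.
  split=> //; split=> //.
    apply: keeps_trans ks2 _; split=> [[|[|a]]//|a i /=|//].
    by rewrite s2n s2r; case: eqP => //= ->; lia.
  exists Q'; rewrite addn1 eqxx /=; rewrite s2r in mg2.
  apply: merging_right srt mg2 kn kpw _ _ _; rewrite ?eqxx //.
    move=> ip; move: C; rewrite ip /= => /negbFE /andP[/andP[jw jn] /ltW ji].
    by split.
  by move=> t /negPf ->.
- rewrite /upd /= sw; split=> //; first by split=> // -[|[|a]].
  by exists 0%N; exact: merging_start.
- move=> s1 [ks s1w s1r [Q mg]]; apply: halts_straight; [by []|exact: erefl|].
  have [|srt' sv] := merging_end mg.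
    by case: mg; lia.
  rewrite /= /upd /= s1w addnA; split=> //.
  by apply: keeps_trans ks _; split=> // -[|[|a]].
Qed.

(** A pass doubles [w], so it uses up one unit of the fuel [r] in [n <= w * 2 ^ r]; with no fuel
    left a single run covers the row. *)
Lemma sort_rowP s n K :
  nmem s 0 0 = n -> nmem s 2 0 = 1%N -> (n <= 2 ^ K)%N ->
  halts sort_row s (K * (n * 250 + 120) + 20) (fun s' =>
    [/\ keeps s s', nondecreasing_on (rmem s' (n + nmem s' 2 0)) 0 n
      & same_values n (rmem s (n + 1)) (rmem s' (n + nmem s' 2 0))]).
Proof.
move=> sn sw nK.
apply: (halts_while (c := n * 250 + 100) (k := K) (I := fun r s1 =>
  [/\ keeps s s1, runs_sorted n (nmem s1 2 0) (rmem s1 (n + nmem s1 2 0)),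
      same_values n (rmem s (n + 1)) (rmem s1 (n + nmem s1 2 0)),
      (0 < nmem s1 2 0)%N & (n <= nmem s1 2 0 * 2 ^ r)%N])).
- move=> r s1 [ks srt sv w0 nr]; rewrite /holds /= -ltnNge.
  have [n1 _ _] := ks; rewrite (n1 0%N) // sn => wn.
  case: r nr => [|r] nr; first by rewrite expn0 in nr; lia.
  split=> //; have s1n : nmem s1 0 0 = n by rewrite n1.
  apply: halts_weaken (passP s1n erefl w0 srt) => // s2 [ks2 s2w srt2 sv2].
  split; rewrite ?s2w //.
  + exact: keeps_trans ks2.
  + exact: same_values_trans sv2.
  + by lia.
  + by rewrite addnn -muln2 -mulnA -expnS.
- split; rewrite ?sw ?mul1n //; first exact: runs_sorted1.
  by split=> i iN; exists i.
- move=> r s1 [ks srt sv w0 nr]; rewrite /holds /= negbK.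
  have [n1 _ _] := ks; rewrite (n1 0%N) // sn => nw; split=> //.
  exact: runs_sorted_all srt.
- by rewrite /=; nia.
Qed.

(** * Binary search with an arbitrary labeling domain, and exclusion of negatives *)

Context (n : nat) (x : nat -> 'rV[R]_d) (h : hypothesis 'rV[R]_d)
  (L : set 'rV[R]_d) (bound : nat -> \bar R).
Context
  (h_bound : forall y,
     h y <-> forall m, (m < d + d)%N -> ((feature m y)%:E <= bound m)%E)
  (xL : forall i, (i < n)%N -> L (x i))
  (lab_truthful : forall hist q, truthful h L q (lab hist q)).

(** Invariant of the binary search. It does not mention [L]; at [hi = n] the last clause is vacuous,
    as no value has been ruled out yet. *)
Definition separates (v : nat -> R) m lo hi : Prop :=
  [/\ (lo <= hi <= n)%N, forall q, (q < lo)%N -> ((v q)%:E <= bound m)%E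
    & forall i, (i < n)%N -> (hi < n)%N -> v hi <= feature m (x i) ->
        h (x i) = false].

(** A positive answer makes the examples from [v mid] on negative, as they lie in [L]. A negative
    one yields a positive point of [L] with feature at least [v mid]; it obeys the bound, hence so
    do [v mid] and all smaller values. *)
Lemma separates_query v m lo hi mid hist :
  (m < d + d)%N -> nondecreasing_on v 0 n ->
  same_values n (fun i => feature m (x i)) v ->
  (lo <= mid < hi)%N -> separates v m lo hi ->
  if lab hist (threshold_query m (v mid)) then separates v m lo mid
  else separates v m mid.+1 hi.
Proof.
move=> md vs [_ vx] /andP[lm mh] [/andP[_ hn] vlo vhi].
have [|i iN vi] := vx mid; first exact: leq_trans hn.
(* The answer is not arbitrary: [v mid] is the feature of some example, so the region meets [L]. *)
have /(_ _)[|yes no] := @lab_truthful hist (threshold_query m (v mid)).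
  by exists (x i); split; [rewrite /= vi|exact: xL].
case: ifPn => [/yes neg|/negP nyes].
  split=> //; first by rewrite lm; lia.
  by move=> k kn _ vk; apply: neg; split; [exact: vk|exact: xL].
have [y [[vy Ly] hy]] : exists y, ((threshold_query m (v mid)).1 `&` L) y /\ h y.
  apply: contra_notP nyes => all_neg; apply: no => y Ty.
  by apply/negP => hy; apply: all_neg; exists y.
split=> [|q qm|//]; first by rewrite mh.
apply: le_trans (proj1 (h_bound y) hy m md); rewrite lee_fin.
by apply: le_trans vy; apply: vs; lia.
Qed.

Definition asks_thresholds s : Prop :=
  forall q, q \in asked s -> threshold_queries q.

(** Each query turns [hi - lo < 2 ^ r.+1] into [hi - lo < 2 ^ r]; the strict bound gives [hi = lo]
    at [r = 0], after at most [K] queries. *)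
Lemma searchP s K m :
  nmem s 0 0 = n -> nmem s 0 2 = m -> (m < d + d)%N -> (n < 2 ^ K)%N ->
  nondecreasing_on (rmem s (n + nmem s 2 0)) 0 n ->
  same_values n (fun i => feature m (x i)) (rmem s (n + nmem s 2 0)) ->
  asks_thresholds s ->
  halts search s (K * (tau + 60) + 50) (fun s' =>
    [/\ forall a i, (a <= 1)%N -> nmem s' a i = nmem s a i,
        nmem s' 2 0 = nmem s 2 0 /\ rmem s' = rmem s,
        separates (rmem s (n + nmem s 2 0)) m (nmem s' 2 5) (nmem s' 2 5),
        asks_thresholds s'
      & (size (asked s') <= size (asked s) + K)%N]).
Proof.
move=> sn sm md nK vs vx sQ; set w := nmem s 2 0; set v := rmem s (n + w).
apply: (halts_seq (T1 := 20) (T2 := (K * (tau + 60) + 30))); first lia.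
apply: halts_straight; [by []|exact: erefl|].
apply: (halts_while (c := tau + 50) (k := K) (I := fun r s1 =>
  [/\ forall a i, (a <= 1)%N -> nmem s1 a i = nmem s a i,
        nmem s1 2 0 = w /\ rmem s1 = rmem s,
        separates v m (nmem s1 2 5) (nmem s1 2 6) /\
        (nmem s1 2 6 - nmem s1 2 5 < 2 ^ r)%N,
        asks_thresholds s1
      & (size (asked s1) + r <= size (asked s) + K)%N])).
- move=> r s1 [s1n [s1w s1r] [sep lt_r] s1Q sz]; rewrite /holds /= -ltnNge => lh.
  case: r lt_r sz => [|r] lt_r sz; first by rewrite expn0 in lt_r; lia.
  rewrite expnS in lt_r.
  split=> //; apply: halts_straight; [by []|by rewrite /=; lia|].
  set mid := (nmem s1 2 5 + nmem s1 2 6)./2.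
  have /andP[lm mh] : (nmem s1 2 5 <= mid < nmem s1 2 6)%N by rewrite /mid; lia.
  have := separates_query (asked s1) md vs vx (introT andP (conj lm mh)) sep.
  rewrite /= /holds /= /upd /= s1w s1r !(s1n 0%N) // sn sm /threshold_naming /= -/mid -/v.
  have Q1 : threshold_queries (threshold_query m (v mid)) by exists m, (v mid).
  case: (lab _ _) => /= sep'; split=> //=; try lia.
  + by case=> [|[|a]] //= i _; rewrite s1n.
  + by split=> //; rewrite /mid; lia.
  + by move=> q; rewrite inE => /orP[/eqP->|/s1Q].
  + by case=> [|[|a]] //= i _; rewrite s1n.
  + by rewrite addn1; split=> //; rewrite /mid; lia.
  + by move=> q; rewrite inE => /orP[/eqP->|/s1Q].
- rewrite /= /upd /= sn; split=> //; first by case=> [|[|a]].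
  split; last by rewrite subn0.
  by split=> //; [rewrite leqnn|move=> i _; rewrite ltnn].
- move=> r s1 [s1n s1w [sep _] s1Q sz]; rewrite /holds /= negbK => hl.
  have [/andP[lh _] _ _] := sep.
  have E : nmem s1 2 6 = nmem s1 2 5 by lia.
  by split=> //; [rewrite E in sep|lia].
- by rewrite /=; nia.
Qed.

Lemma excludeP s lo :
  nmem s 0 0 = n -> nmem s 2 5 = lo ->
  (forall k j, (k < n)%N -> rmem s k j = coord_at (x k) j) ->
  halts exclude s (n * 100 + 50) (fun s' =>
    [/\ forall i, nmem s' 0 i = nmem s 0 i, rmem s' = rmem s,
        asked s' = asked s &
        forall i, (i < n)%N -> nmem s' 1 i =
          if (lo < n)%N && (rmem s (n + nmem s 2 0) lo <= feature (nmem s 0 2) (x i))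
          then 0%N else nmem s 1 i]).
Proof.
move=> sn slo sx.
apply: (halts_seq (T1 := 20) (T2 := (n * (80 + 10) + 10))); first lia.
apply: halts_straight; [by []|exact: erefl|].
apply: (halts_for (I := fun k s1 =>
    [/\ forall i, nmem s1 0 i = nmem s 0 i,
        nmem s1 2 0 = nmem s 2 0 /\ nmem s1 2 5 = lo, rmem s1 = rmem s,
        asked s1 = asked s &
        forall i, nmem s1 1 i =
          if [&& (i < k)%N, (lo < n)%N &
            rmem s (n + nmem s 2 0) lo <= feature (nmem s 0 2) (x i)]
          then 0%N else nmem s 1 i])) => //.
- move=> k s1 kn [s1z [s1w s1lo] s1r s1a s1l] s1n s1k.
  apply: halts_straight; [by []|exact: erefl|].
  rewrite /= /holds /= subn_halves s1w s1lo s1n s1k s1r s1z (sx k) // -/(feature _ _).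
  rewrite -ltnNge; case: ifP => C; rewrite /upd /= ?s1n ?s1k ?addn1 //.
    split=> //; split=> // i; have [->|ik] := eqVneq i k.
      by rewrite ltnS leqnn C.
    by rewrite s1l ltnS (leq_eqVlt i) (negPf ik).
  split=> //; split=> // i; rewrite s1l; have [->|ik] := eqVneq i k.
    by rewrite ltnS leqnn ltnn C.
  by rewrite ltnS (leq_eqVlt i) (negPf ik).
- by move=> s1 [s1z _ s1r s1a s1l]; split=> // i iN; rewrite s1l iN.
Qed.

(** Invariant between features: labels err only towards +1, and a surviving +1 has passed every
    earlier feature. At [m = 2d] the two clauses make the labels equal to [h]. *)
Definition learned K m s : Prop :=
  [/\ [/\ nmem s 0 0 = n, nmem s 0 1 = d & nmem s 0 2 = m],
      forall k j, (k < n)%N -> rmem s k j = coord_at (x k) j,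
      asks_thresholds s /\ (size (asked s) <= m * K)%N
    & forall i, (i < n)%N -> exists b : bool, [/\ nmem s 1 i = b, h (x i) -> b
        & b -> forall m', (m' < m)%N -> ((feature m' (x i))%:E <= bound m')%E]].

Lemma feature_roundP K m s :
  (n < 2 ^ K)%N -> (m < d + d)%N -> learned K m s ->
  halts feature_round s (250 * (K + 1) * (tau + n + 1)) (learned K m.+1).
Proof.
move=> nK md [[sn sd sm] sx [sQ sz] sl].
apply: (halts_seq (T1 := n * 100 + 50 + (K * (n * 250 + 120) + 20))
  (T2 := K * (tau + 60) + 50 + (n * 100 + 50) + 20)); first nia.
apply: (halts_seq (leqnn _)).
apply: halts_weaken (copy_featureP sn sx) => // s1 [ks1 s1w s1x].
have [n1 r1 a1] := ks1.
have s1n : nmem s1 0 0 = n by rewrite n1.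
apply: halts_weaken (sort_rowP s1n s1w (ltnW nK)) => // s2 [ks2 srt sv].
have [n2 r2 a2] := keeps_trans ks1 ks2.
have s2n : nmem s2 0 0 = n by rewrite n2.
have s2m : nmem s2 0 2 = m by rewrite n2.
rewrite sm in s1x.
have sv2 : same_values n (fun i => feature m (x i)) (rmem s2 (n + nmem s2 2 0)).
  case: sv => sv vs; split=> i iN.
    by have [j jn E] := sv i iN; exists j => //; rewrite E s1x.
  by have [j jn E] := vs i iN; exists j => //; rewrite E s1x.
have s2Q : asks_thresholds s2 by move=> q; rewrite a2; exact: sQ.
apply: (halts_seq (leqnn _)); apply: (halts_seq (leqnn _)).
apply: halts_weaken (searchP s2n s2m md nK srt sv2 s2Q) => //.
move=> s3 [n3 [s3w s3r] sep s3Q s3a].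
have s3n : nmem s3 0 0 = n by rewrite n3.
have s3x k j : (k < n)%N -> rmem s3 k j = coord_at (x k) j.
  by move=> kn; rewrite s3r r2 ?sn // sx.
apply: halts_weaken (excludeP s3n erefl s3x) => // s4 [n4 r4 a4 l4].
apply: halts_straight; [by []|exact: erefl|].
rewrite /= /upd /=; split=> /=.
- by rewrite !n4 !n3 // s2n s2m addn1 n2 // sd.
- by move=> k j kn; rewrite r4 s3x.
- by split; [move=> q /=; rewrite a4; exact: s3Q|rewrite a4 mulSn; move: s3a; rewrite a2; lia].
- move=> i iN; rewrite l4 // (n3 1%N) // (n2 1%N) // (n3 0%N) // s2m s3r s3w.
  have [b [-> hb bf]] := sl i iN; case: sep => /andP[_ lon] vlo vhi.
  case: ifP => [/andP[ln vf]|C].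
    by exists false; split=> //; rewrite vhi.
  exists b; split=> // bt m'; rewrite ltnS leq_eqVlt => /orP[/eqP->|]; last exact: bf.
  (* The feature of example [i] is some [v j]. If [lo <= j], then [v lo <= v j] by sortedness and
     the example would have been excluded; so [j < lo]. *)
  have [j jn fj] := sv2.1 i iN.
  rewrite -fj; apply: vlo; rewrite ltnNge; apply/negP => loj.
  move: C; rewrite (leq_ltn_trans loj jn) /= -fj => /negP; apply.
  exact: srt.
Qed.

Lemma box_learnerP K s :
  (n < 2 ^ K)%N ->
  (forall a i, nmem s a i =
     if (a == 0) && (i == 0) then n
     else if (a == 0) && (i == 1) then d else 0)%N ->
  (forall k j, (k < n)%N -> rmem s k j = coord_at (x k) j) -> asked s = [::] ->
  halts box_learner s (600 * (d + 1) * (K + 1) * (tau + n + 1)) (fun s' =>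
    [/\ asks_thresholds s', (size (asked s') <= (d + d) * K)%N
      & forall i, (i < n)%N -> nmem s' 1 i = h (x i)]).
Proof.
move=> nK sE sx sa.
apply: (halts_seq (T1 := n * (20 + 10) + 10)
  (T2 := (d + d) * (20 + 250 * (K + 1) * (tau + n + 1)).+1 + 20)); first nia.
apply: (halts_for (I := fun k s1 =>
  [/\ forall i, nmem s1 0 i = nmem s 0 i, rmem s1 = rmem s, asked s1 = [::]
    & forall i, (i < k)%N -> nmem s1 1 i = 1%N])); rewrite ?sE //.
  move=> k s1 kn [s1z s1r s1a s1l] s1n s1k.
  apply: halts_straight; [by []|exact: erefl|].
  rewrite /= /upd /= s1k addn1; split=> //; split=> // i; rewrite ltnS.
  by rewrite leq_eqVlt; case: eqP => //= _; exact: s1l.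
move=> s1 [s1z s1r s1a s1l].
apply: (halts_while (c := 250 * (K + 1) * (tau + n + 1)) (k := d + d)
  (I := fun r s2 => exists2 m, (m + r = d + d)%N & learned K m s2)).
- move=> r s2 [m mr ln]; have [[_ s2d s2m] _ _ _] := ln.
  rewrite /holds /= -ltnNge s2m s2d => md; split; first lia.
  apply: halts_weaken (feature_roundP nK md ln) => // s3 ln3.
  by exists m.+1 => //; lia.
- exists 0%N => //; split.
  + by rewrite !s1z !sE.
  + by move=> k j kn; rewrite s1r sx.
  + by rewrite /asks_thresholds s1a.
  + by move=> i iN; exists true; rewrite s1l.
- move=> r s2 [m mr [[_ s2d s2m] _ [s2Q s2a] s2l]].
  rewrite /holds /= negbK s2m s2d => dm; have E : m = (d + d)%N by lia.
  rewrite E in s2a s2l; split=> // i iN.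
  have [b [-> hb bh]] := s2l i iN.
  have [hx|nhx] := boolP (h (x i)); first by rewrite hb.
  by case: b bh {hb} => // /(_ isT) /h_bound; rewrite (negPf nhx).
- by rewrite /=; nia.
Qed.

End Run.
End Learner.

(** * The VC dimension of the query class *)

(* A chain has at most one trace of each size on [A]. *)
Lemma shatters_chains (T : Type) (F : set (set T)) (A : set T) k c
    (C : 'I_c -> set (set T)) :
  (forall U, F U -> exists i, C i U) ->
  (forall i U V, C i U -> C i V -> U `<=` V \/ V `<=` U) ->
  (A #= `I_k)%card -> shatters F A -> (2 ^ k <= c * k.+1)%N.
Proof.
move=> FC Cchain /card_set_bijP[f [_ _ fsurj]] shat.
have /choice[g gP] (i : 'I_k) : exists y, A y /\ f y = i.
  by have [y Ay fy] := fsurj i (ltn_ord i); exists y.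
pose img (B : {set 'I_k}) : set T := 
    [set y | exists2 i : 'I_k, i \in B & g i = y].
(* Each index set [B] gets a set of the family with trace [B], together with a chain containing
   it. *)
have cut (B : {set 'I_k}) : exists Ui : set T * 'I_c,
    C Ui.2 Ui.1 /\ forall i : 'I_k, Ui.1 (g i) <-> i \in B.
  have [|U FU UA] := shat (img B).
    by move=> _ [i _ <-]; case: (gP i).
  have [i CU] := FC _ FU; exists (U, i); split=> // j /=; split=> [Uj|jB].
    have : (U `&` A) (g j) by split=> //; case: (gP j).
    rewrite UA => -[l lB /(congr1 f)].
    by rewrite (gP l).2 (gP j).2 => /val_inj <-.
  by have [] : (U `&` A) (g j) by rewrite UA; exists j.
have {cut} [Ui cut] := choice cut.
have sub B B' : (Ui B).1 `<=` (Ui B').1 -> B \subset B'.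
  by move=> UU; apply/fintype.subsetP => i /(cut B).2 /UU /(cut B').2.
(* Traces of one chain are nested, so equal sizes mean equal traces and [phi] is injective; [inord]
   is faithful as a size is at most [k]. *)
pose phi (B : {set 'I_k}) : 'I_c * 'I_k.+1 := ((Ui B).2, inord #|B|).
have cardI (B : {set 'I_k}) : (#|B| < k.+1)%N.
  by rewrite ltnS -[leqRHS]card_ord max_card.
have phi_inj : injective phi.
  move=> B B' [iE /(congr1 val)]; rewrite /= !inordK // => cE.
  have := (cut B).1; rewrite iE => CB.
  case: (Cchain _ _ _ CB (cut B').1) => /sub BB; apply/eqP.
    by rewrite eqEcard BB cE /=.
  by rewrite eq_sym eqEcard BB cE /=.
have := leq_card phi phi_inj.
by rewrite card_prod !card_ord -cardsT -powersetT card_powerset cardsT card_ord.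
Qed.

(** Squaring the hypothesis and using [(k + 1)^2 <= 4 * 2^k] lets a factor [2^k] cancel. *)
Lemma expn2_le_sqr k c : (2 ^ k <= c * k.+1)%N -> (2 ^ k <= 4 * c ^ 2)%N.
Proof.
have sq : (k.+1 ^ 2 <= 4 * 2 ^ k)%N.
  (* The induction step rests on [(k + 2)^2 <= 2 (k + 1)^2], false for [k = 0, 1]; these cases are
     checked directly. *)
  elim: k => // -[//|[//|k]] IH.
  by rewrite (expnS 2); move: IH; rewrite -!mulnn; nia.
move=> h; rewrite -(@leq_pmul2r (2 ^ k)) ?expn_gt0 // mulnn.
have : ((2 ^ k) ^ 2 <= (c * k.+1) ^ 2)%N by rewrite leq_sqr.
by rewrite expnMn; nia.
Qed.

(** * Logarithm estimates and the VC bound *)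

Lemma ln2_bounds (R : realType) : 1 / 2 <= ln (2 : R) <= 1.
Proof.
(* Both bounds are instances of [ln (1 + x) <= x], at [x = 1] and at [x = -1/2]. *)
apply/andP; split; last by have := @le_ln1Dx R 1; apply; lra.
have := @le_ln1Dx R (- (1 / 2)).
have -> : 1 + - (1 / 2) = (2 : R)^-1 by field.
by rewrite lnV ?posrE //; lra.
Qed.

Lemma le_ln_expn2 (R : realType) k n :
  (2 ^ k <= n)%N -> k%:R <= 2 * ln (n%:R : R).
Proof.
move=> kn; have n0 : (0 < n)%N by apply: leq_trans kn; rewrite expn_gt0.
have : ln ((2 : R) ^+ k) <= ln n%:R.
  by rewrite ler_ln ?posrE ?exprn_gt0 ?ltr0n // -natrX ler_nat.
rewrite lnXn // -(mulr_natl (ln _)); have /andP[l2 _] := ln2_bounds R.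
move=> kl; have k0 : (0 : R) <= k%:R by [].
have := ler_wpM2l k0 l2; lra.
Qed.

Lemma log1_ge1 (R : realType) n : 1 <= log1 R n.
Proof. by rewrite /log1 le_max lexx. Qed.

Lemma trunc_log_le_log1 (R : realType) n :
  (trunc_log 2 n)%:R <= 2 * log1 R n.
Proof.
have [->|n0] := posnP n.
  by rewrite trunc_log0; have := log1_ge1 R 0; lra.
apply: (le_trans (le_ln_expn2 R (trunc_logP _ n0))) => //.
by rewrite ler_pM2l // /log1 le_max lexx orbT.
Qed.

Lemma threshold_vc_dim (R : realType) d :
  (0 < d)%N ->
  (query_vc_dim R (@threshold_queries R d) <= (20 * log1 R d)%:E)%E.
Proof.
move=> d0; apply: ge_ereal_sup => _ [k [A [Ak shat]] <-]; rewrite lee_fin.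
pose C (i : 'I_(d + d)) : set (set 'rV[R]_d) :=
  [set U | exists c, U = [set x | c <= feature i x]].
have /expn2_le_sqr : (2 ^ k <= (d + d) * k.+1)%N.
  apply: (shatters_chains (C := C) _ _ Ak shat) => [U [z [m [c [md [-> _]]]]]|].
    by exists (Ordinal md), c.
  move=> i _ _ [c ->] [c' ->]; case: (leP c c') => cc; [right|left] => x /=.
    exact: le_trans.
  by apply: le_trans; exact: ltW.
(* From [2^k <= 16 d^2] follows [k <= 8 ln 2 + 4 ln d], at most [12 * log1 R d]. *)
have -> : (4 * (d + d) ^ 2 = 2 ^ 4 * d ^ 2)%N by lia.
move=> /(le_ln_expn2 R); rewrite natrM !natrX.
have dgt0 : (0 : R) < d%:R by rewrite ltr0n.
rewrite lnM ?posrE ?exprn_gt0 // !lnXn //.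
have /andP[_ l2] := ln2_bounds R; have := log1_ge1 R d.
have : ln d%:R <= log1 R d by rewrite /log1 le_max lexx orbT.
rewrite -!(mulr_natl (ln _)); lra.
Qed.

(** * Boxes as bounds on features, and the theorem *)

Definition side (R : realType) d (a b : 'I_d -> \bar R) (m : nat) : \bar R :=
  if insub m./2 is Some j then if odd m then (- a j)%E else b j else +oo%E.

Lemma featureE (R : realType) d m (y : 'rV[R]_d) :
  feature m y = if odd m then - coord_at y m./2 else coord_at y m./2.
Proof.
rewrite /feature; case: (odd m); last by rewrite subr0 mul1r.
by rewrite (_ : 1 - _ = -1) ?mulN1r // -[(true + true)%N]/2%N; ring.
Qed.

(** Feature [2j] carries the upper side [b j]; feature [2j + 1] is minus coordinate [j], so the
    lower side [a j] becomes its upper bound [- a j]. *)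
Lemma box_sides (R : realType) d (a b : 'I_d -> \bar R) y :
  box a b y <-> forall m, (m < d + d)%N -> ((feature m y)%:E <= side a b m)%E.
Proof.
split=> [/forallP inb m md|le_side].
  rewrite featureE /side /coord_at; case: insubP => [j _ _|]; last by lia.
  have /andP[aj bj] := inb j; case: (odd m) => //.
  by rewrite EFinN leeN2.
apply/forallP => j; have jd := ltn_ord j; apply/andP; split.
  have := le_side (j + j).+1; rewrite featureE /side /coord_at.
  have -> : (((j + j).+1)./2 = j)%N by lia.
  rewrite valK oddS oddD addbb /= EFinN leeN2; apply; lia.
have := le_side (j + j)%N; rewrite featureE /side /coord_at.
have -> : ((j + j)./2 = j)%N by lia.
by rewrite valK oddD addbb /=; apply; lia.
Qed.

Theorem theorem3p2 (R : realType) :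
  exists (C : R) (A : program),
  forall d : nat, (0 < d)%N ->
  exists (Q : set (region_query 'rV[R]_d)) (nm : query_naming R d),
    (query_vc_dim R Q <= (C * log1 R d)%:E)%E /\
    forall (S : seq 'rV[R]_d) (h : hypothesis 'rV[R]_d) (L : set 'rV[R]_d)
           (lab : labeler 'rV[R]_d) (tau : nat),
      uniq S -> boxes h -> [set` S] `<=` L ->
      (forall hist q, truthful h L q (lab hist q)) ->
      (0 < tau)%N ->
      exists (t : nat) (s : state R d),
        [/\ exec nm lab tau A (input S) t s,
            t%:R <= C * (tau + size S)%:R * d%:R * log1 R (size S),
            (size (asked s))%:R <= C * d%:R * log1 R (size S),
            (forall q, q \in asked s -> Q q)
          & labels_correctly S h s].
Proof.
(* The time bound needs [2400 * 4 = 9600]; the query count needs 8 and the VC dimension 20. *)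
exists (100 * 100), box_learner => d d0.
exists (@threshold_queries R d), (@threshold_naming R d); split.
  apply: le_trans (threshold_vc_dim R d0) _; rewrite lee_fin.
  by have := log1_ge1 R d; lra.
move=> S h L lab tau _ [a [b ->]] SL truth tau0.
have [|||||t [s [e tT [sQ sa sl]]]] := @box_learnerP R d lab tau (size S)
    (nth 0 S) (box a b) L (side a b) (box_sides a b) _ truth
    (trunc_log 2 (size S)).+1 (input S).
- by move=> i iS; apply: SL; exact: mem_nth.
- exact: trunc_log_ltn.
- by move=> [|[|i]] [|[|j]].
- by [].
- by [].
have := trunc_log_le_log1 R (size S); have := log1_ge1 R (size S).
set l := log1 R _; set r := trunc_log _ _ in tT sa * => l1 rl.
have r2 : (r + 2)%:R <= 4 * l by rewrite natrD; lra.
have d_ge0 : (0 : R) <= d%:R by [].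
exists t, s; split=> //.
(* Here [2400 = 600 * 2 * 2]: since [d] and [tau] are positive, [d + 1 <= 2d] and
   [tau + n + 1 <= 2 (tau + n)] for [n = size S]. *)
- have tN : (t <= 2400 * ((tau + size S) * d * (r + 2)))%N.
    apply: leq_trans tT _.
    apply: (@leq_trans (600 * (2 * d) * (r + 2) * (2 * (tau + size S)))).
      by rewrite !leq_mul //; lia.
    lia.
  apply: (@le_trans _ _ (2400%:R * ((tau + size S)%:R * d%:R * (r + 2)%:R))).
    by rewrite -!natrM ler_nat.
  have nd_ge0 : (0 : R) <= (tau + size S)%:R * d%:R by apply: mulr_ge0.
  have ndl_ge0 : 0 <= (tau + size S)%:R * d%:R * l by apply: mulr_ge0 => //; lra.
  have := ler_wpM2l nd_ge0 r2; lra.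
- have sN : (size (asked s) <= 2 * (d * (r + 2)))%N.
    by apply: leq_trans sa _; lia.
  apply: (@le_trans _ _ (2 * (d%:R * (r + 2)%:R))).
    by rewrite -!natrM ler_nat.
  have dl_ge0 : 0 <= d%:R * l by apply: mulr_ge0 => //; lra.
  have := ler_wpM2l d_ge0 r2; lra.
Qed.
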